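(* Let $ABC$ be a (nondegenerate) triangle in the Euclidean plane and let $AA_1, AA_2, BB_1, BB_2, CC_1, CC_2$ be six distinct cevians of it, with $A_1, A_2$ on the line $(BC)$, $B_1, B_2$ on the line $(AC)$ and $C_1, C_2$ on the line $(AB)$. If these six cevians have equal lengths, $$AA_1 = AA_2 = BB_1 = BB_2 = CC_1 = CC_2,$$ then the points $A_1, A_2, B_1, B_2, C_1, C_2$ lie on one conic.
   Context: A cevian of a triangle is a segment joining a vertex of the triangle to a point that lies on the opposite side or on its extension and is different from the endpoints of that side. $(XY)$ denotes the line through points $X$ and $Y$. A conic is a plane curve given by a polynomial equation of degree $2$. *)

(* Defs.v *)
From HB Require Import structures.
From mathcomp Require Import all_boot all_order all_algebra.
From mathcomp Require Import mpoly.
From mathcomp Require Import classical_sets reals.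

Set Implicit Arguments.
Unset Strict Implicit.
Unset Printing Implicit Defensive.

Import Order.TTheory GRing.Theory Num.Theory.

Local Open Scope ring_scope.
Local Open Scope classical_set_scope.

(* Points of the Euclidean plane, as coordinate row vectors. *)
Notation plane R := 'rV[R]_2.

Section Plane.
Variable R : realType.
Implicit Types (A B C P X Y : plane R) (S : set (plane R)).

(* Not the norm that MathComp-Analysis puts on matrices, which is the sup
   norm. *)
Definition dist X Y : R := Num.sqrt (\sum_(i < 2) (X 0 i - Y 0 i) ^+ 2).

(* The line (XY), provided that X and Y are distinct. *)
Definition line X Y : set (plane R) :=
  [set P | exists t : R, P = X + t *: (Y - X)].

(* Without A != B, the degenerate case A = B <> C would be accepted, as
   [line A A] is reduced to the point A. *)
Definition triangle A B C : Prop := A != B /\ ~ line A B C.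

(* P is the foot of a cevian drawn from the vertex opposite to the side XY;
   P may lie outside of the segment XY. *)
Definition cevian_foot X Y P : Prop := [/\ line X Y P, P != X & P != Y].

(* The total degree of p is (msize p).-1 when p is nonzero, and p.@[P 0] is
   the value of p at the two coordinates of P. Degenerate conics are
   included. *)
Definition conic S : Prop :=
  exists2 p : {mpoly R[2]}, msize p = 3%N & S = [set P | p.@[P 0] = 0].

End Plane.

(* Main.v *)
Require Import Defs.
From HB Require Import structures.
From mathcomp Require Import all_boot all_order all_algebra.
From mathcomp Require Import mpoly.
From mathcomp Require Import classical_sets reals.
From mathcomp Require Import ring.

Import Order.TTheory GRing.Theory Num.Theory.

Local Open Scope ring_scope.
Local Open Scope classical_set_scope.

(** Let [d] be the square of the common length and put [u = |BC|^2 - d],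
    [v = |CA|^2 - d], [w = |AB|^2 - d].  Let [x, y, z] be barycentric
    coordinates for [A, B, C].  At a point of the side [x = 0] with
    [y + z = 1], the squared distance to [A] exceeds [d] by
      [w y^2 + v z^2 + (v + w - u - d) y z],
    so that the feet of the cevians from [A] are zeros of this form.  Multiplied
    by [u], it is the restriction to [x = 0] of the quadratic form
      [v w x^2 + w u y^2 + u v z^2 + u (v + w - u - d) y z
         + v (w + u - v - d) z x + w (u + v - w - d) x y],
    which is symmetric in the three vertices; hence it vanishes at all six
    feet ([cevian_conic_foot]).  That the restrictions to the three sides can be
    matched in this way is what Carnot's theorem says here.

    The form is not zero: its value at [B] is [w u] times the square of twice
    the area of the triangle, and [w <> 0], because otherwise the line [(BC)]
    would meet the circle of centre [A] and squared radius [d] in the three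
    points [B], [A1] and [A2] ([cevian_foot_sqdist]); likewise [u <> 0], from
    the side [(AC)].  A nonzero polynomial of degree at most 2 divides one of
    degree 2, so that its zeros lie on a conic ([conic_of_msize_le]). *)

Section CevianConic.
Set Implicit Arguments.
Unset Strict Implicit.
Variable R : realType.
Implicit Types (A B C P Q X Y Z : plane R) (d : R).

(** The square of the Euclidean distance. *)
Definition sqdist X Y : R :=
  (X 0 0 - Y 0 0) ^+ 2 + (X 0 1 - Y 0 1) ^+ 2.

(** Twice the signed area of the triangle [XYP]. *)
Definition area X Y P : R :=
  (X 0 0 - P 0 0) * (Y 0 1 - P 0 1) - (X 0 1 - P 0 1) * (Y 0 0 - P 0 0).

(** [area X Y P] as a polynomial in the coordinates of [P]. *)
Definition area_mpoly X Y : {mpoly R[2]} :=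
  (X 0 0 * Y 0 1 - X 0 1 * Y 0 0)%:MP
  + (X 0 1 - Y 0 1) *: 'X_0 + (Y 0 0 - X 0 0) *: 'X_1.

(** The quadratic form through the six feet, in the unnormalised barycentric
    coordinates given by the signed areas; [d] stands for the squared length
    of the cevians. *)
Definition cevian_conic A B C d : {mpoly R[2]} :=
  let u := sqdist B C - d in
  let v := sqdist C A - d in
  let w := sqdist A B - d in
  let x := area_mpoly B C in
  let y := area_mpoly C A in
  let z := area_mpoly A B in
  (v * w) *: (x * x) + (w * u) *: (y * y) + (u * v) *: (z * z)
  + (u * (v + w - u - d)) *: (y * z)
  + (v * (w + u - v - d)) *: (z * x)
  + (w * (u + v - w - d)) *: (x * y).

Lemma ord2P (i : 'I_2) : i = 0 \/ i = 1.
Proof. by case: i => [[|[|]]] // ?; [left|right]; exact: val_inj. Qed.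

Lemma dist_sqdist X Y X' Y' :
  dist X Y = dist X' Y' -> sqdist X Y = sqdist X' Y'.
Proof.
have sqE Z Z' : sqdist Z Z' = dist Z Z' ^+ 2.
  rewrite /dist sqr_sqrtr; last by apply: sumr_ge0 => i _; exact: sqr_ge0.
  rewrite big_ord_recl big_ord1 /sqdist.
  by rewrite (_ : lift ord0 ord0 = 1) //; exact: val_inj.
by rewrite !sqE => ->.
Qed.

Lemma sqdistC X Y : sqdist X Y = sqdist Y X.
Proof. by rewrite /sqdist; ring. Qed.

Lemma sqdist_eq0 X Y : (sqdist X Y == 0) = (X == Y).
Proof.
apply/idP/eqP => [|->]; last by rewrite /sqdist !subrr expr0n addr0.
rewrite paddr_eq0 ?sqr_ge0 // !sqrf_eq0 !subr_eq0 => /andP[/eqP e0 /eqP e1].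
by apply/rowP => i; case: (ord2P i) => ->.
Qed.

Lemma meval_area X Y P : (area_mpoly X Y).@[P 0] = area X Y P.
Proof.
by rewrite /area_mpoly !mevalD !mevalZ mevalC !mevalXU /area; ring.
Qed.

Lemma msizeD_leq (p q : {mpoly R[2]}) k :
  (msize p <= k)%N -> (msize q <= k)%N -> (msize (p + q) <= k)%N.
Proof.
by move=> pk qk; rewrite (leq_trans (msizeD_le _ _)) // geq_max pk.
Qed.

Lemma msize_area X Y : (msize (area_mpoly X Y) <= 2)%N.
Proof.
apply: msizeD_leq; first apply: msizeD_leq.
- by rewrite msizeC; case: eqP.
- by rewrite (leq_trans (msizeZ_le _ _)) // msizeX mdeg1.
- by rewrite (leq_trans (msizeZ_le _ _)) // msizeX mdeg1.
Qed.

Lemma msize_cevian_conic A B C d : (msize (cevian_conic A B C d) <= 3)%N.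
Proof.
have leM c X Y X' Y' :
    (msize (c *: (area_mpoly X Y * area_mpoly X' Y')) <= 3)%N.
  rewrite (leq_trans (msizeZ_le _ _)) //.
  have [->|p0] := eqVneq (area_mpoly X Y) 0; first by rewrite mul0r msize0.
  have [->|q0] := eqVneq (area_mpoly X' Y') 0; first by rewrite mulr0 msize0.
  by rewrite msizeM // -subn1 leq_subLR (leq_add (msize_area _ _) (msize_area _ _)).
by do 5![apply: msizeD_leq; last exact: leM]; exact: leM.
Qed.

Lemma meval_cevian_conic A B C d P :
  (cevian_conic A B C d).@[P 0] =
  let u := sqdist B C - d in
  let v := sqdist C A - d in
  let w := sqdist A B - d in
  let x := area B C P in
  let y := area C A P in
  let z := area A B P in
  v * w * (x * x) + w * u * (y * y) + u * v * (z * z)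
  + u * (v + w - u - d) * (y * z)
  + v * (w + u - v - d) * (z * x)
  + w * (u + v - w - d) * (x * y).
Proof. by rewrite /cevian_conic /= !mevalD !mevalZ !mevalM !meval_area. Qed.

Lemma cevian_conic_rot A B C d P :
  (cevian_conic A B C d).@[P 0] = (cevian_conic B C A d).@[P 0].
Proof. by rewrite !meval_cevian_conic /=; ring. Qed.

Lemma cevian_conic_swap A B C d P :
  (cevian_conic A B C d).@[P 0] = (cevian_conic A C B d).@[P 0].
Proof.
have areaC X Y : area Y X P = - area X Y P by rewrite /area; ring.
rewrite !meval_cevian_conic /= (sqdistC C B) (sqdistC A C) (sqdistC B A).
by rewrite (areaC B C) (areaC C A) (areaC A B); ring.
Qed.

Lemma cevian_conic_foot A B C d P :
  line B C P -> sqdist A P = d -> (cevian_conic A B C d).@[P 0] = 0.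
Proof.
move=> [t ->] <-; rewrite meval_cevian_conic /sqdist /area !mxE /=.
by ring.
Qed.

Lemma cevian_conic_vertex A B C d :
  (cevian_conic A B C d).@[B 0] =
  (sqdist A B - d) * (sqdist B C - d) * area A B C ^+ 2.
Proof. by rewrite meval_cevian_conic /area /=; ring. Qed.

Lemma area_triangle A B C : triangle A B C -> area A B C != 0.
Proof.
move=> [AB nABC]; apply/eqP => S0; apply: nABC.
have s0 : sqdist A B != 0 by rewrite sqdist_eq0.
(* [dot / sqdist A B] is the parameter of the orthogonal projection of [C] on
   the line (AB); the projection is [C] itself, as the area is zero. *)
pose dot := (C 0 0 - A 0 0) * (B 0 0 - A 0 0)
            + (C 0 1 - A 0 1) * (B 0 1 - A 0 1).
have dotE k : sqdist A B * (C 0 k - A 0 k) = dot * (B 0 k - A 0 k).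
  case: (ord2P k) => ->.
    transitivity (dot * (B 0 0 - A 0 0) + (A 0 1 - B 0 1) * area A B C).
      by rewrite /dot /area /sqdist; ring.
    by rewrite S0 mulr0 addr0.
  transitivity (dot * (B 0 1 - A 0 1) + (B 0 0 - A 0 0) * area A B C).
    by rewrite /dot /area /sqdist; ring.
  by rewrite S0 mulr0 addr0.
exists (dot / sqdist A B); apply/rowP => k; rewrite !mxE.
by rewrite mulrAC -dotE mulrAC mulfV // mul1r addrC subrK.
Qed.

(** A line meets a circle in at most two points: the circle of centre [A]
    through [P] meets the line (XY) in [P] and [Q], hence not in [X]. *)
Lemma cevian_foot_sqdist A X Y P Q :
  cevian_foot X Y P -> cevian_foot X Y Q -> P != Q ->
  sqdist A P = sqdist A Q -> sqdist A X - sqdist A P != 0.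
Proof.
move=> [[s Ps] PX _] [[t Qt] QX _] PQ ePQ.
pose m := (A 0 0 - X 0 0) * (Y 0 0 - X 0 0) + (A 0 1 - X 0 1) * (Y 0 1 - X 0 1).
have onl r : sqdist A X - sqdist A (X + r *: (Y - X))
    = r * (2 * m - r * sqdist X Y).
  by rewrite /sqdist /m !mxE; ring.
have s0 : s != 0 by apply: contraNneq PX => s0; rewrite Ps s0 scale0r addr0.
have t0 : t != 0 by apply: contraNneq QX => t0; rewrite Qt t0 scale0r addr0.
have XY : sqdist X Y != 0.
  rewrite sqdist_eq0; apply: contraNneq PX => XY.
  by rewrite Ps XY subrr scaler0 addr0.
apply: contraNneq PQ => /[dup]; rewrite {2}ePQ Ps Qt !onl => /eqP.
rewrite mulf_eq0 (negPf s0) subr_eq0 => /= /eqP es /eqP.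
rewrite mulf_eq0 (negPf t0) subr_eq0 => /= /eqP et.
by have /(mulIf XY) -> : s * sqdist X Y = t * sqdist X Y by rewrite -es -et.
Qed.

(** If the degree of [p] is less than 2, it is raised to 2 by multiplying [p]
    by a power of a variable. *)
Lemma conic_of_msize_le (p : {mpoly R[2]}) :
  p != 0 -> (msize p <= 3)%N ->
  exists2 S, conic S & [set P : plane R | p.@[P 0] = 0] `<=` S.
Proof.
move=> p0 p3; pose q : {mpoly R[2]} := 'X_[U_(0) *+ (3 - msize p)].
exists [set P : plane R | (p * q).@[P 0] = 0]; last first.
  by move=> P /= pP; rewrite mevalM pP mul0r.
have sq : msize q = (3 - msize p).+1 by rewrite msizeX mdegMn mdeg1 mul1n.
exists (p * q) => //.
by rewrite msizeM ?sq ?addnS ?subnKC // -msize_poly_eq0 sq.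
Qed.

End CevianConic.

(* A cevian is given by the pair (vertex, foot). As no foot is a vertex of the
   triangle, distinct pairs are exactly distinct segments. *)
Theorem mainTheorem6 (R : realType) (A B C A1 A2 B1 B2 C1 C2 : plane R)
    (hABC : triangle A B C)
    (hA1 : cevian_foot B C A1) (hA2 : cevian_foot B C A2)
    (hB1 : cevian_foot A C B1) (hB2 : cevian_foot A C B2)
    (hC1 : cevian_foot A B C1) (hC2 : cevian_foot A B C2)
    (hdistinct : uniq [:: (A, A1); (A, A2); (B, B1); (B, B2); (C, C1); (C, C2)])
    (hlength : [/\ dist A A1 = dist A A2, dist A A2 = dist B B1,
                   dist B B1 = dist B B2, dist B B2 = dist C C1
                 & dist C C1 = dist C C2]) :
  exists2 S : set (plane R), conic S & [set A1; A2; B1; B2; C1; C2] `<=` S.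
Proof.
have A12 : A1 != A2.
  by apply: contraTneq hdistinct => ->; rewrite /= !inE eqxx.
have B12 : B1 != B2.
  by apply: contraTneq hdistinct => ->; rewrite /= !inE eqxx /= !andbF.
case: hlength => /dist_sqdist eA /dist_sqdist eAB /dist_sqdist eB.
move=> /dist_sqdist eBC /dist_sqdist eC.
pose d := sqdist A A1.
have dA2 : sqdist A A2 = d by rewrite -eA.
have dB1 : sqdist B B1 = d by rewrite -eAB.
have dB2 : sqdist B B2 = d by rewrite -eB.
have dC1 : sqdist C C1 = d by rewrite -eBC.
have dC2 : sqdist C C2 = d by rewrite -eC.
have w0 : sqdist A B - d != 0 by exact: cevian_foot_sqdist hA1 hA2 A12 eA.
have u0 : sqdist B C - d != 0.
  have footC P : cevian_foot A C P -> cevian_foot C A P.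
    move=> [[t ->] PA PC]; split=> //; exists (1 - t).
    by apply/rowP => i; rewrite !mxE; ring.
  rewrite -dB1.
  exact: (@cevian_foot_sqdist _ B C A B1 B2 (footC _ hB1) (footC _ hB2)).
have p0 : cevian_conic A B C d != 0.
  apply/eqP => /(congr1 (meval (B 0))); apply/eqP.
  rewrite cevian_conic_vertex meval0.
  by rewrite !mulf_neq0 // area_triangle.
have [S cS pS] := @conic_of_msize_le _ _ p0 (msize_cevian_conic _ _ _ _).
exists S => // P PS; apply: pS => /=; move: PS.
case: hA1 hA2 => [lA1 _ _] [lA2 _ _].
case: hB1 hB2 => [lB1 _ _] [lB2 _ _].
case: hC1 hC2 => [lC1 _ _] [lC2 _ _].
move=> [[[[[->|->]|->]|->]|->]|->].
- exact: cevian_conic_foot.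
- exact: cevian_conic_foot.
- rewrite cevian_conic_rot cevian_conic_swap; exact: cevian_conic_foot.
- rewrite cevian_conic_rot cevian_conic_swap; exact: cevian_conic_foot.
- rewrite 2!cevian_conic_rot; exact: cevian_conic_foot.
- rewrite 2!cevian_conic_rot; exact: cevian_conic_foot.
Qed.
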